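(* Let $k\ge 1$ be an integer and let $G$ be a finite simple graph of order $n$. Then $$\gamma_{kR}(G)\cdot d_{R}^k(G)\le 2kn.$$ Moreover, if $\gamma_{kR}(G)\cdot d_{R}^k(G)=2kn$, then for each Roman $(k,k)$-dominating family $\{f_1,\ldots,f_d\}$ on $G$ with $d=d_R^k(G)$, each function $f_i$ is a Roman $k$-dominating function of weight $\gamma_{kR}(G)$, and $\sum_{i=1}^d f_i(v)=2k$ for all $v\in V(G)$.
   Context: Let $k\ge1$ be an integer. A Roman $k$-dominating function (RkDF) on a graph $G$ is a map $f:V(G)\to\{0,1,2\}$ such that every vertex $v$ with $f(v)=0$ has at least $k$ neighbors $u$ with $f(u)=2$. Its weight is $\sum_{v\in V(G)}f(v)$. The Roman $k$-domination number $\gamma_{kR}(G)$ is the minimum weight of an RkDF on $G$. A set $\{f_1,\ldots,f_d\}$ of pairwise distinct RkDFs on $G$ with $\sum_{i=1}^d f_i(v)\le 2k$ for every $v\in V(G)$ is a Roman $(k,k)$-dominating family on $G$; the maximum number of functions in such a family is the Roman $(k,k)$-domatic number $d_R^k(G)$. *)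

(* Defs.v *)
From mathcomp Require Import all_boot.

Set Implicit Arguments.
Unset Strict Implicit.
Unset Printing Implicit Defensive.

Section RomanDomination.

Variables (k : nat) (V : finType) (e : rel V).

(* 'I_3 = {0, 1, 2}; {ffun _ -> _} makes distinctness of functions extensional *)
Definition label := {ffun V -> 'I_3}.

Definition roman_kdom (f : label) : bool :=
  [forall v, (f v == 0 :> nat) ==> (k <= #|[set u | e v u & f u == 2 :> nat]|)].

Definition weight (f : label) : nat := \sum_(v : V) f v.

(* the constant function 2 is always Roman k-dominating (see roman_kdom2), so
   it is a valid starting point for the minimum *)
Definition label2 : label := [ffun=> ord_max].

Definition roman_kdom_number : nat :=
  weight [arg min_(f < label2 | roman_kdom f) weight f].

Definition roman_kk_family (F : {set label}) : bool :=
  [forall f in F, roman_kdom f] && [forall v, \sum_(f in F) f v <= 2 * k].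

Definition roman_kk_domatic_number : nat :=
  \max_(F : {set label} | roman_kk_family F) #|F|.

Lemma roman_kdom2 : roman_kdom label2.
Proof. by apply/forallP=> v; rewrite ffunE. Qed.

Lemma roman_kdom_numberP :
  (exists2 f, roman_kdom f & weight f = roman_kdom_number) /\
  (forall f, roman_kdom f -> roman_kdom_number <= weight f).
Proof.
rewrite /roman_kdom_number; case: arg_minnP => [|f f_dom f_min].
  exact: roman_kdom2.
by split=> //; exists f.
Qed.

Lemma roman_kk_domatic_numberP :
  (exists2 F, roman_kk_family F & #|F| = roman_kk_domatic_number) /\
  (forall F, roman_kk_family F -> #|F| <= roman_kk_domatic_number).
Proof.
split=> [|F famF]; last exact: (@leq_bigmax_cond _ roman_kk_family (fun F => #|F|) F famF).
have fam0 : roman_kk_family set0.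
  apply/andP; split; first by apply/forallP=> f; rewrite inE.
  by apply/forallP=> v; rewrite big_set0.
have [|F famF maxF] := @eq_bigmax_cond _ roman_kk_family (fun F => #|F|).
  by apply/card_gt0P; exists set0.
by exists F.
Qed.

End RomanDomination.

(* Main.v *)
(* Count the total weight of a Roman (k,k)-dominating family F in two ways:
   function by function it is at least gamma_kR(G) |F|, and vertex by vertex it
   is at most 2kn. Equality of the outer bounds forces equality in every term
   of both sums. *)

Require Import Defs.
From mathcomp Require Import all_boot.

Section DoubleCounting.

Variables (k : nat) (V : finType) (e : rel V) (F : {set label V}).
Hypothesis famF : roman_kk_family k e F.

Lemma roman_kk_family_kdom f : f \in F -> roman_kdom k e f.
Proof. by case/andP: famF => /forall_inP domF _; apply: domF. Qed.

(** The form [?= iff] carries the equality case along with the bound: a sum of termwise inequalities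
    is tight exactly when every term is. *)
Lemma roman_kk_family_weight_lb :
  roman_kdom_number k e * #|F| <= \sum_(f in F) weight f
    ?= iff [forall (f | f \in F), roman_kdom_number k e == weight f].
Proof.
rewrite mulnC -sum_nat_const; apply: leqif_sum => f /roman_kk_family_kdom domf.
by split=> //; apply: (roman_kdom_numberP k e).2.
Qed.

(** After exchanging the two sums, the family condition caps the inner sum at each vertex by
    [2 * k]. *)
Lemma roman_kk_family_weight_ub :
  \sum_(f in F) weight f <= 2 * k * #|V|
    ?= iff [forall v, \sum_(f in F) f v == 2 * k].
Proof.
rewrite mulnC -sum_nat_const /weight exchange_big /=.
apply: leqif_sum => v _; split=> //.
by case/andP: famF => _ /forallP.
Qed.

End DoubleCounting.

Theorem theorem1 (k : nat) (V : finType) (e : rel V) (n : nat)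
    (k_ge1 : 1 <= k) (e_sym : symmetric e) (e_irr : irreflexive e)
    (order_G : #|V| = n) :
  roman_kdom_number k e * roman_kk_domatic_number k e <= 2 * k * n
  /\ (roman_kdom_number k e * roman_kk_domatic_number k e = 2 * k * n ->
      forall F : {set label V},
        roman_kk_family k e F -> #|F| = roman_kk_domatic_number k e ->
        (forall f : label V, f \in F ->
           roman_kdom k e f /\ weight f = roman_kdom_number k e)
        /\ (forall v : V, \sum_(f in F) f v = 2 * k)).
Proof.
have bounds F (famF : roman_kk_family k e F) :=
  leqif_trans (roman_kk_family_weight_lb _ _ _ _ famF)
              (roman_kk_family_weight_ub _ _ _ _ famF).
split=> [|eq_prod F famF cardF].
  (* A family of maximum size turns the bound on [#|F|] into one on the domatic number. *)
  have [[F famF <-] _] := roman_kk_domatic_numberP k e.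
  by rewrite -order_G; apply: (bounds F famF).1.
(* Equality of the outer terms amounts to the conjunction of both equality conditions; by [eq_prod]
   it holds, hence so do they. *)
have [_] := bounds F famF; rewrite cardF order_G eq_prod eqxx.
move=> /esym/andP[/forall_inP eq_weight /forallP eq_sum].
split=> [f fF | v]; last exact/eqP.
by split; [apply: roman_kk_family_kdom famF _ fF | apply/esym/eqP/eq_weight].
Qed.
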